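(* Let $(Z,M)$ be a Möbius space. There exists an extended quasi-metric $\rho$ on $Z$ inducing $M$ if and only if $M$ is a strong Möbius structure. Furthermore, whenever there exists an extended $K$-quasi-metric inducing $M$, there exists a bounded $K^2$-quasi-metric inducing $M$.
   Context: Tuples. A tuple of points of $Z$ is admissible if no three of its entries (at distinct positions) coincide, and non-degenerate if its entries are pairwise distinct. $\mathcal{A}$ is the set of admissible quadruples in $Z^4$. Let $L_4=\{(x,y,z)\in\mathbb{R}^3\mid x+y+z=0\}$ and $\overline{L_4}=L_4\cup\{(0,\infty,-\infty),(-\infty,0,\infty),(\infty,-\infty,0)\}$. Let $E_1=(12)(34)$, $E_2=(13)(42)$, $E_3=(14)(23)$ be the three pairings of $\{1,2,3,4\}$. For $\pi\in\mathcal{S}_4$ let $\varphi(\pi)\in\mathcal{S}_3$ be given by $\pi(E_i)=E_{\varphi(\pi)(i)}$. $\mathcal{S}_4$ acts by $\pi(z_1,\dots,z_4)=(z_{\pi(1)},\dots,z_{\pi(4)})$ and $\varphi(\pi)(u_1,u_2,u_3)=(u_{\varphi(\pi)(1)},u_{\varphi(\pi)(2)},u_{\varphi(\pi)(3)})$. Möbius structure. Let $Z$ have at least three points. A map $M=(a,b,c):\mathcal{A}\to\overline{L_4}$ is a Möbius structure, and $(Z,M)$ a Möbius space, if: 1) $M(\pi P)=\mathrm{sgn}(\pi)\varphi(\pi)M(P)$ for all $P\in\mathcal{A}$, $\pi\in\mathcal{S}_4$; 2) for $P\in\mathcal{A}$: $M(P)\in L_4$ iff $P$ is non-degenerate; 3)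 $M(x,x,y,z)=(0,\infty,-\infty)$ whenever $(x,x,y,z)\in\mathcal A$; 4) for every admissible $5$-tuple $(x,y,\omega,\alpha,\beta)$ with $(\omega,\alpha,\beta)$ non-degenerate, $\alpha\ne x\ne\beta$, $\alpha\neq y\neq\beta$, there is $\lambda\in\mathbb{R}\cup\{\pm\infty\}$ with $M(\alpha,x,\omega,\beta)+M(\alpha,\omega,y,\beta)-M(\alpha,x,y,\beta)=(\lambda,-\lambda,0)$; moreover the first component of the left side is well-defined whenever $(\omega,\alpha,\beta)$ is non-degenerate, $x\neq\beta$, $y\ne\alpha$, and the second whenever $(\omega,\alpha,\beta)$ is non-degenerate, $x\neq\alpha$, $y\neq\beta$. Cross ratio triple. Let $\overline\Delta=\{(a:b:c)\in\mathbb{R}P^2\mid a,b,c>0\}\cup\{(0:1:1),(1:0:1),(1:1:0)\}$. The map $crt:\mathcal{A}\to\overline\Delta$ associated with $M$ is $crt(P)=(e^{(c-b)/3}:e^{(a-c)/3}:e^{(b-a)/3})$ if $M(P)=(a,b,c)\in L_4$, and $crt(P)=(0:1:1),(1:0:1),(1:1:0)$ if $M(P)=(0,\infty,-\infty),(-\infty,0,\infty),(\infty,-\infty,0)$ respectively. A strong Möbius structure is a Möbius structure satisfying the (corner)-condition: there exist open neighbourhoods of $(1:0:0),(0:1:0),(0:0:1)$ in $\mathbb{R}P^2$ which the image of $crt$ does not intersect. Quasi-metrics. A $K$-quasi-metric ($K\ge1$) on $Z$ is a symmetric map $\rho:Z\times Z\to[0,\infty)$ with $\rho(z,z')=0$ iff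 $z=z'$ and $\rho(x,z)\le K\max(\rho(x,y),\rho(y,z))$ for all $x,y,z$. An extended $K$-quasi-metric is a symmetric map $\rho:Z\times Z\to[0,\infty]$ with exactly one point $\omega\in Z$ (point at infinity) such that $\rho(x,\omega)=\infty$ for all $x\neq\omega$, $\rho(\omega,\omega)=0$, and the restriction of $\rho$ to $Z\setminus\{\omega\}$ is a $K$-quasi-metric. A(n extended) quasi-metric is a(n extended) $K$-quasi-metric for some $K\ge 1$. Bounded means $\sup\rho<\infty$. A (possibly extended) quasi-metric $\rho$ induces $M$ if $crt(z_1,z_2,z_3,z_4)=(\rho(z_1,z_2)\rho(z_3,z_4):\rho(z_1,z_3)\rho(z_2,z_4):\rho(z_1,z_4)\rho(z_2,z_3))$ on $\mathcal{A}$, where infinite distances cancel each other (e.g. $crt(z_1,z_2,z_3,\omega)=(\rho(z_1,z_2):\rho(z_1,z_3):\rho(z_2,z_3))$ and $crt(z_1,z_2,\omega,\omega)=(0:1:1)$). *)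

(* Defs.v *)
From HB Require Import structures.
From mathcomp Require Import all_boot all_order all_algebra all_fingroup.
From mathcomp Require Import all_classical all_reals all_analysis.
Import Order.TTheory GRing.Theory Num.Theory numFieldNormedType.Exports.

Set Implicit Arguments.
Unset Strict Implicit.
Unset Printing Implicit Defensive.

Local Open Scope classical_set_scope.
Local Open Scope ring_scope.
Local Open Scope quotient_scope.

Section ProjectivePlane.
Variable R : realType.

Definition nonzero_row : set 'rV[R]_3 := [set v | v != 0].

(* Nonzero vectors, with the subspace topology. *)
Definition nzrow : Type := set_type nonzero_row.
HB.instance Definition _ := Topological.on nzrow.
HB.instance Definition _ := SubType.on nzrow.

Definition collinear (v w : nzrow) : bool :=
  `[< exists2 k : R, k != 0 & val w = k *: val v >].

Lemma collinear_refl : reflexive collinear.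
Proof. by move=> v; apply/asboolP; exists 1; rewrite ?oner_neq0 ?scale1r. Qed.

Lemma collinear_symW v w : collinear v w -> collinear w v.
Proof.
move=> /asboolP[k k0 vw]; apply/asboolP; exists k^-1; first by rewrite invr_eq0.
by rewrite vw scalerA mulVf ?scale1r.
Qed.

Lemma collinear_sym : symmetric collinear.
Proof. by move=> v w; apply/idP/idP; exact: collinear_symW. Qed.

Lemma collinear_trans : transitive collinear.
Proof.
move=> w v u /asboolP[k k0 vw] /asboolP[l l0 wu]; apply/asboolP.
by exists (l * k); rewrite ?mulf_neq0// wu vw scalerA.
Qed.

Canonical collinear_equiv :=
  EquivRel collinear collinear_refl collinear_sym collinear_trans.

Definition RP2 : Type := quotient_topology {eq_quot collinear_equiv}.
HB.instance Definition _ := Topological.on RP2.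
HB.instance Definition _ := Quotient.on RP2.

Lemma row1_neq0 : (const_mx 1 : 'rV[R]_3) \in nonzero_row.
Proof.
rewrite inE /nonzero_row/=; apply/eqP => /rowP/(_ 0).
by rewrite !mxE => /eqP; rewrite oner_eq0.
Qed.

(* The point (x : y : z); as homogeneous coordinates are not all zero, the
   value (1 : 1 : 1) given to (0 : 0 : 0) is a dummy. *)
Definition homog (x y z : R) : RP2 :=
  \pi_RP2 (insubd (Sub (const_mx 1) row1_neq0 : nzrow)
                  (\row_i tnth [tuple x; y; z] i)).

End ProjectivePlane.

Lemma RP2_eq (R : realType) (v w : nzrow R) :
  v = w %[mod RP2 R] <-> collinear v w.
Proof.
split=> [vw|vw]; first exact/(@eqmodP _ (collinear_equiv R)).
exact: (elimT (@eqmodP _ (collinear_equiv R) v w) vw).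
Qed.

Lemma homog_eq (R : realType) (x y z x' y' z' : R) :
  (x, y, z) != (0, 0, 0) -> (x', y', z') != (0, 0, 0) ->
  homog x y z = homog x' y' z' <->
  exists2 k : R, k != 0 & [/\ x' = k * x, y' = k * y & z' = k * z].
Proof.
have row_nz a b c : (a, b, c) != (0, 0, 0) ->
    (\row_i tnth [tuple a; b; c] i : 'rV[R]_3) \in @nonzero_row R.
  move=> abc; rewrite inE /nonzero_row/=; apply: contra abc => /eqP/rowP abc.
  have := (abc 0, abc 1, abc 2); rewrite !mxE/= => -[[]].
  by rewrite !(tnth_nth 0)/= => -> -> ->.
move=> /row_nz v0 /row_nz w0; rewrite /homog; split.
  move=> /RP2_eq/asboolP[k k0]; rewrite !val_insubd v0 w0 => /rowP vw.
  exists k => //; have := (vw 0, vw 1, vw 2); rewrite !mxE/= !(tnth_nth 0)/=.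
  by move=> [[]].
move=> [k k0 [xE yE zE]]; move: w0; rewrite {}xE {}yE {}zE => w0.
apply/RP2_eq/asboolP; exists k => //.
rewrite !val_insubd v0 w0; apply/rowP => i; rewrite !mxE.
by rewrite !(tnth_nth 0); case: i => [[|[|[|m]]] hi].
Qed.

Lemma RP2_open (R : realType) (U : set (RP2 R)) :
  open U <-> exists2 V : set 'rV[R]_3, open V &
    forall v : nzrow R, V (val v) <-> U (\pi v).
Proof.
split=> [[V oV VU]|[V oV VU]]; exists V => //.
  by move=> v; have : (set_val @^-1` V) v <-> (\pi_(RP2 R) @^-1` U) v by rewrite VU.
by apply/seteqP; split=> v /VU.
Qed.

Definition admissible (T : Type) n (P : n.-tuple T) : Prop :=
  forall i j k : 'I_n, i != j -> j != k -> i != k ->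
    ~ (tnth P i = tnth P j /\ tnth P j = tnth P k).

Definition nondegenerate (T : Type) n (P : n.-tuple T) : Prop :=
  injective (tnth P).

Definition permute (T : Type) n (s : 'S_n) (P : n.-tuple T) : n.-tuple T :=
  [tuple tnth P (s i) | i < n].

(* The positions 1, 2, 3, 4 (and 1, 2, 3) are the ordinals 0, 1, 2, 3. *)
Definition pairing (i : 'I_3) : {set {set 'I_4}} :=
  tnth [tuple [set [set 0; 1]; [set 2; 3]];
              [set [set 0; 2]; [set 3; 1]];
              [set [set 0; 3]; [set 1; 2]]]%SET i.

Definition permute_pairing (p : 'S_4) (E : {set {set 'I_4}}) :
  {set {set 'I_4}} := [set p @: B | B : {set 'I_4} in E]%SET.

(* The lemma [phiP] below shows that the default value is never used. *)
Definition phi (p : 'S_4) : 'S_3 :=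
  odflt 1%g [pick s : 'S_3 |
    [forall i, permute_pairing p (pairing i) == pairing (s i)]].

Lemma ord4P (i : 'I_4) : [\/ i = 0, i = 1, i = 2 | i = 3].
Proof.
by case: i => [[|[|[|[|m]]]] hi] //; [constructor 1|constructor 2|constructor 3
  |constructor 4]; apply: val_inj.
Qed.

Lemma ord3P (i : 'I_3) : [\/ i = 0, i = 1 | i = 2].
Proof.
by case: i => [[|[|[|m]]] hi] //; [constructor 1|constructor 2|constructor 3];
  apply: val_inj.
Qed.

Lemma pairing_setC (i : 'I_3) (B : {set 'I_4}) :
  B \in pairing i -> pairing i = [set B; ~: B]%SET.
Proof.
have C B1 B2 : ~: B1 = B2 :> {set 'I_4} -> B \in [set B1; B2]%SET ->
    [set B1; B2]%SET = [set B; ~: B]%SET.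
  by move=> <-; rewrite !inE => /orP[] /eqP->; rewrite ?finset.setCK// finset.setUC.
by case: (ord3P i) => ->; apply: C; apply/finset.setP => x;
  case: (ord4P x) => ->; rewrite !inE.
Qed.

Lemma pairing_set2 (a b : 'I_4) : a != b ->
  exists i, [set a; b]%SET \in pairing i.
Proof.
case: (ord4P a) => ->; case: (ord4P b) => -> // _;
  by [exists 0; rewrite !inE ?eqxx ?orbT // finset.setUC ?eqxx ?orbT
     |exists 1; rewrite !inE ?eqxx ?orbT // finset.setUC ?eqxx ?orbT
     |exists 2; rewrite !inE ?eqxx ?orbT // finset.setUC ?eqxx ?orbT].
Qed.

Lemma permute_pairing_ex (p : 'S_4) (i : 'I_3) :
  exists j, permute_pairing p (pairing i) = pairing j.
Proof.
have [a [b [ab abi]]] : exists a b : 'I_4, a != b /\ [set a; b]%SET \in pairing i.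
  by case: (ord3P i) => ->; [exists 0, 1|exists 0, 2|exists 0, 3];
    rewrite !inE eqxx.
have [|j pj] := @pairing_set2 (p a) (p b); first by rewrite (inj_eq perm_inj).
exists j; rewrite (pairing_setC abi) (pairing_setC pj) /permute_pairing.
rewrite imsetU1 imset_set1 imsetU1 imset_set1; congr [set _; _]%SET.
apply/finset.setP => x; rewrite -[x](permKV p) mem_imset ?inE; last exact: perm_inj.
by rewrite !(inj_eq perm_inj).
Qed.

Lemma pairing_inj : injective pairing.
Proof.
have H (i j : 'I_3) (c : 'I_4) : pairing i = pairing j ->
    [set 0; c]%SET \in pairing i -> [set 0; c]%SET \in pairing j by move=> ->.
have N (c d e f : 'I_4) : [set 0; c]%SET \in [set [set 0; d]; [set e; f]]%SET ->
    0 \notin [set e; f]%SET -> c \in [set 0; d]%SET.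
  rewrite !inE => /orP[/eqP/finset.setP/(_ c)|/eqP/finset.setP/(_ 0)].
    by rewrite !inE eqxx orbT => <-.
  by rewrite !inE => <-.
move=> i j; case: (ord3P i) => ->; case: (ord3P j) => -> // E.
- by have := N _ _ _ _ (H _ _ 1 E (set21 _ _)); rewrite !inE => /(_ isT).
- by have := N _ _ _ _ (H _ _ 1 E (set21 _ _)); rewrite !inE => /(_ isT).
- by have := N _ _ _ _ (H _ _ 2 E (set21 _ _)); rewrite !inE => /(_ isT).
- by have := N _ _ _ _ (H _ _ 2 E (set21 _ _)); rewrite !inE => /(_ isT).
- by have := N _ _ _ _ (H _ _ 3 E (set21 _ _)); rewrite !inE => /(_ isT).
- by have := N _ _ _ _ (H _ _ 3 E (set21 _ _)); rewrite !inE => /(_ isT).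
Qed.

Lemma phiP (p : 'S_4) (i : 'I_3) :
  permute_pairing p (pairing i) = pairing (phi p i).
Proof.
rewrite /phi; case: pickP => [s /forallP/(_ i)/eqP //|] /=.
have [f fP] := fin_all_exists (permute_pairing_ex p).
have f_inj : injective f.
  move=> j k fjk; apply: pairing_inj; apply: (imset_inj (imset_inj perm_inj)).
  by have := fP j; rewrite fjk -fP; apply.
move=> /(_ (perm f_inj))/negP[]; apply/forallP => j.
by rewrite permE fP.
Qed.

Section Moebius.
Variables (R : realType) (Z : Type).
Local Open Scope ereal_scope.

Definition L4 (u : 3.-tuple (\bar R)) : Prop :=
  exists a b c : R, (a + b + c = 0)%R /\ u = [tuple a%:E; b%:E; c%:E].

Definition Linf1 : 3.-tuple (\bar R) := [tuple 0; +oo; -oo].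
Definition Linf2 : 3.-tuple (\bar R) := [tuple -oo; 0; +oo].
Definition Linf3 : 3.-tuple (\bar R) := [tuple +oo; -oo; 0].

Definition L4bar (u : 3.-tuple (\bar R)) : Prop :=
  [\/ L4 u, u = Linf1, u = Linf2 | u = Linf3].

(* [M] is a total function, of which only the values at admissible quadruples
   are ever constrained or used. *)
Implicit Type M : 4.-tuple Z -> 3.-tuple (\bar R).

Definition sign_scale (p : 'S_4) (u : 3.-tuple (\bar R)) :
  3.-tuple (\bar R) := [tuple ((-1) ^+ p)%:E * tnth u i | i < 3].

(* No [oo - oo] occurs in [x + y - z]. *)
Definition well_defined (x y z : \bar R) : bool :=
  adde_def x y && adde_def (x + y) (- z).

Definition cocycle_component M (x y w a b : Z) (i : 'I_3) : \bar R :=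
  tnth (M [tuple a; x; w; b]) i + tnth (M [tuple a; w; y; b]) i
    - tnth (M [tuple a; x; y; b]) i.

Definition cocycle_defined M (x y w a b : Z) (i : 'I_3) : bool :=
  well_defined (tnth (M [tuple a; x; w; b]) i)
    (tnth (M [tuple a; w; y; b]) i) (tnth (M [tuple a; x; y; b]) i).

Record moebius_structure M : Prop := MoebiusStructure {
  three_points : exists x y z : Z, [/\ x <> y, y <> z & x <> z];
  moebius_L4bar : forall P, admissible P -> L4bar (M P);
  moebius_permute : forall P (p : 'S_4), admissible P ->
    M (permute p P) = sign_scale p (permute (phi p) (M P));
  moebius_L4 : forall P, admissible P -> (L4 (M P) <-> nondegenerate P);
  moebius_Linf1 : forall x y z, admissible [tuple x; x; y; z] ->
    M [tuple x; x; y; z] = Linf1;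
  moebius_cocycle : forall x y w a b, admissible [tuple x; y; w; a; b] ->
    nondegenerate [tuple w; a; b] -> a <> x -> x <> b -> a <> y -> y <> b ->
    (forall i, cocycle_defined M x y w a b i) /\
    exists l : \bar R,
      [tuple cocycle_component M x y w a b i | i < 3] = [tuple l; - l; 0];
  moebius_defined1 : forall x y w a b, admissible [tuple x; y; w; a; b] ->
    nondegenerate [tuple w; a; b] -> x <> b -> y <> a ->
    cocycle_defined M x y w a b 0%R;
  moebius_defined2 : forall x y w a b, admissible [tuple x; y; w; a; b] ->
    nondegenerate [tuple w; a; b] -> x <> a -> y <> b ->
    cocycle_defined M x y w a b 1%R }.

Definition crt_of (u : 3.-tuple (\bar R)) : RP2 R :=
  if u == Linf1 then homog 0 1 1
  else if u == Linf2 then homog 1 0 1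
  else if u == Linf3 then homog 1 1 0
  else let a := fine (tnth u 0%R) in
       let b := fine (tnth u 1%R) in
       let c := fine (tnth u 2%R) in
       homog (expR ((c - b) / 3)) (expR ((a - c) / 3)) (expR ((b - a) / 3)).

Definition crt M (P : 4.-tuple Z) : RP2 R := crt_of (M P).

Definition corner_condition M : Prop :=
  forall p, p = homog 1 0 0 \/ p = homog 0 1 0 \/ p = homog 0 0 1 ->
  exists2 U : set (RP2 R), open_nbhs p U &
    crt M @` [set P | admissible P] `&` U = set0.

Definition strong_moebius_structure M : Prop :=
  moebius_structure M /\ corner_condition M.

Implicit Type rho : Z -> Z -> \bar R.

(* The restriction of [rho] to [D] is a [K]-quasi-metric; finite values are
   kept in [\bar R] to treat quasi-metrics and extended ones uniformly. *)
Definition quasi_metric_on (D : set Z) (K : R) rho : Prop :=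
  [/\ (1 <= K)%R,
      forall x y, D x -> D y -> 0 <= rho x y < +oo,
      forall x y, D x -> D y -> rho x y = rho y x,
      forall x y, D x -> D y -> (rho x y = 0 <-> x = y) &
      forall x y z, D x -> D y -> D z ->
        rho x z <= K%:E * Order.max (rho x y) (rho y z)].

Definition quasi_metric (K : R) rho : Prop := quasi_metric_on setT K rho.

Definition extended_quasi_metric (K : R) rho : Prop :=
  [/\ forall x y, 0 <= rho x y,
      forall x y, rho x y = rho y x &
      exists! w : Z, [/\ forall x, x <> w -> rho x w = +oo, rho w w = 0 &
        quasi_metric_on [set x | x <> w] K rho]].

Definition bounded_distance rho : Prop :=
  ereal_sup [set rho xy.1 xy.2 | xy in [set: Z * Z]] < +oo.

(* A point at infinity occurring once in an admissible quadruple contributes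
   exactly one infinite factor to each of the three products. Occurring twice,
   it contributes two infinite factors to two of the products and the factor
   rho(w, w) = 0, along with a finite one, to the third. In both cases
   cancelling the infinite distances amounts to replacing them by 1.
   At most one of the resulting products is 0, since two of them being 0 would
   force three entries to coincide. *)
Definition cancel_oo (x : \bar R) : R := if x == +oo then 1%R else fine x.

Definition induces rho M : Prop :=
  forall z1 z2 z3 z4 : Z, admissible [tuple z1; z2; z3; z4] ->
    let r x y := cancel_oo (rho x y) in
    crt M [tuple z1; z2; z3; z4] =
      homog (r z1 z2 * r z3 z4) (r z1 z3 * r z2 z4) (r z1 z4 * r z2 z3).

End Moebius.

(* Main.v *)
Require Import Defs.
From mathcomp Require Import all_boot all_order all_algebra all_fingroup.
From mathcomp Require Import all_classical all_reals all_analysis.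
From mathcomp Require Import ring lra.
Import Order.TTheory GRing.Theory Num.Theory numFieldNormedType.Exports Defs.

(** The third component of a Moebius structure is the logarithm of a cross
    ratio xy . zt / (xz . yt). The symmetry condition recovers the other two
    components from it, and the cocycle condition makes it additive in its two
    inner arguments. Sending [t] to a fixed point [w] leaves the logarithm of
    xy / xz, which is a cocycle in [y, z] ([lratio_cocycle]) whose cyclic sums
    vanish ([lratio_sum0]); such a function is a difference of values of a
    symmetric function, the logarithm of a distance on Z minus [w] ([ldistB],
    [ldistC]). Every cross ratio is then the one computed from these distances
    ([lcr_log_dist]), so that the distance, extended by infinity at [w],
    induces the structure ([crt_real_dist]). At the quadruples (x, z, y, w) the
    cross ratio triple is (xz : xy : yz), and these triples avoid a
    neighbourhood of the corner (1 : 0 : 0) exactly when xz is at most a fixed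
    constant times the maximum of xy and yz. The corner condition thus gives the
    quasi-metric inequality ([strong_extended_quasi_metric]).

    Conversely, let rho be an extended K-quasi-metric inducing the structure,
    with infinite distances counted as 1. Dividing rho(x, y) by factors
    at [x] and at [y] does not change the induced cross ratios
    ([homog_conformal]). For a point [o] other than the point at infinity let
    m(x) = max(1, rho(x, o)). The quotient rho(x, y) / (m(x) m(y)) is bounded
    by K, and its K^2-quasi-metric inequality reads
    rho(x, z) m(y) <= K^2 max(rho(x, y) m(z), rho(y, z) m(x)). This is the
    Ptolemy inequality, valid with constant K^2 in a K-quasi-metric space
    ([ptolemy]), for x, y, z and one more point at distance m from them
    ([bounded_dist_triangle]). Ptolemy's inequality for the bounded
    quasi-metric so obtained bounds each of the three products in the cross
    ratio triple by a constant times the maximum of the others, which is the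
    corner condition ([quasi_metric_corner]). *)

Set Implicit Arguments.
Unset Strict Implicit.
Unset Printing Implicit Defensive.

Local Open Scope classical_set_scope.
Local Open Scope ring_scope.
Local Open Scope quotient_scope.

(** * Tuples and pairings *)

Lemma nondegenerate_admissible T n (P : n.-tuple T) :
  nondegenerate P -> admissible P.
Proof. by move=> Pinj i j k /eqP ij _ _ [/Pinj]. Qed.

Lemma nondegenerate3 T (x y z : T) :
  x <> y -> x <> z -> y <> z -> nondegenerate [tuple x; y; z].
Proof.
move=> xy xz yz i j.
by case: (ord3P i) => ->; case: (ord3P j) => -> //=;
  rewrite !(tnth_nth x)/= // => /esym.
Qed.

Lemma nondegenerate4 T (x y z t : T) :
  x <> y -> x <> z -> x <> t -> y <> z -> y <> t -> z <> t ->
  nondegenerate [tuple x; y; z; t].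
Proof.
move=> xy xz xt yz yt zt i j.
by case: (ord4P i) => ->; case: (ord4P j) => -> //=;
  rewrite !(tnth_nth x)/= // => /esym.
Qed.

Lemma nondegenerate4_neq T (x y z t : T) : nondegenerate [tuple x; y; z; t] ->
  [/\ x <> y, x <> z & x <> t] /\ [/\ y <> z, y <> t & z <> t].
Proof.
move=> nd; split.
  by split=> eq; [have := nd 0 1 eq|have := nd 0 2 eq|have := nd 0 3 eq].
by split=> eq; [have := nd 1 2 eq|have := nd 1 3 eq|have := nd 2 3 eq].
Qed.

Lemma nondegenerate5 T (x y z t u : T) :
  x <> y -> x <> z -> x <> t -> x <> u -> y <> z -> y <> t -> y <> u ->
  z <> t -> z <> u -> t <> u -> nondegenerate [tuple x; y; z; t; u].
Proof.
move=> xy xz xt xu yz yt yu zt zu tu [[|[|[|[|[|i]]]]] hi] //;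
  move=> [[|[|[|[|[|j]]]]] hj] //; rewrite !(tnth_nth x)/= // => eq_ij;
  by [exact: val_inj|have := esym eq_ij].
Qed.

Lemma admissible4 T (x y z t : T) : ~ (x = y /\ y = z) -> ~ (x = y /\ y = t) ->
  ~ (x = z /\ z = t) -> ~ (y = z /\ z = t) -> admissible [tuple x; y; z; t].
Proof.
move=> xyz xyt xzt yzt i j k.
by case: (ord4P i) => ->; case: (ord4P j) => -> //; case: (ord4P k) => -> //;
  rewrite !(tnth_nth x)/= => _ _ _ [] ? ?; subst; tauto.
Qed.

(** The degenerate admissible quadruples are sorted by one of the pairs of
    positions that carry equal entries. *)
Lemma admissible4P T (x y z t : T) : admissible [tuple x; y; z; t] ->
  [/\ x <> y, x <> z & x <> t] /\ [/\ y <> z, y <> t & z <> t] \/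
  [\/ [/\ x = y, x <> z & x <> t], [/\ z = t, z <> x & z <> y]
    | [\/ [/\ x = z, x <> y & x <> t], [/\ y = t, y <> x & y <> z]
      | [\/ [/\ x = t, x <> y & x <> z] | [/\ y = z, y <> x & y <> t]]]].
Proof.
move=> adm.
have [xyz xyt xzt yzt] : [/\ ~ (x = y /\ y = z), ~ (x = y /\ y = t),
    ~ (x = z /\ z = t) & ~ (y = z /\ z = t)].
  by split; [exact: (adm 0 1 2)|exact: (adm 0 1 3)|exact: (adm 0 2 3)
            |exact: (adm 1 2 3)].
have [xy|xy] := pselect (x = y).
  by right; constructor 1; split=> // ?; subst; auto.
have [zt|zt] := pselect (z = t).
  by right; constructor 2; split=> // ?; subst; auto.
have [xz|xz] := pselect (x = z).
  by right; constructor 3; constructor 1; split=> // ?; subst; auto.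
have [yt|yt] := pselect (y = t).
  by right; constructor 3; constructor 2; split=> // ?; subst; auto.
have [xt|xt] := pselect (x = t).
  by right; do 2 constructor 3; constructor 1; split=> // ?; subst; auto.
have [yz|yz] := pselect (y = z).
  by right; do 2 constructor 3; constructor 2; split=> // ?; subst; auto.
by left.
Qed.

(** A pairing is determined by any one of its blocks, so [phi p] can be read
    off from the image of one block of each pairing. *)
Lemma phi_eq (p : 'S_4) (i j : 'I_3) (a b : 'I_4) :
  [set a; b]%SET \in pairing i -> [set p a; p b]%SET \in pairing j ->
  phi p i = j.
Proof.
move=> abi pabj; apply: pairing_inj; rewrite (pairing_setC pabj).
apply: pairing_setC; rewrite -phiP; apply/imsetP.
by exists [set a; b]%SET => //; rewrite imsetU1 imset_set1.
Qed.

(** * Symmetries of a Moebius structure *)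

Section Symmetries.
Variables (R : realType) (Z : Type) (M : 4.-tuple Z -> 3.-tuple (\bar R)).
Hypothesis HM : moebius_structure M.
Implicit Types x y z t w : Z.

Lemma permute_even (p : 'S_4) P (i j : 'I_3) (a b : 'I_4) :
  admissible P -> odd_perm p = false ->
  [set a; b]%SET \in pairing i -> [set p a; p b]%SET \in pairing j ->
  tnth (M (permute p P)) i = tnth (M P) j.
Proof.
move=> admP p_even abi pabj; have pij := phi_eq abi pabj.
rewrite (moebius_permute HM)// /sign_scale !tnth_mktuple.
by rewrite p_even mul1e pij.
Qed.

Lemma tuple3_eq (T : Type) (u v : 3.-tuple T) :
  tnth u 0 = tnth v 0 -> tnth u 1 = tnth v 1 -> tnth u 2 = tnth v 2 -> u = v.
Proof. by move=> *; apply: eq_from_tnth => i; case: (ord3P i) => ->. Qed.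

Lemma tuple4_eq (T : Type) (u v : 4.-tuple T) :
  tnth u 0 = tnth v 0 -> tnth u 1 = tnth v 1 -> tnth u 2 = tnth v 2 ->
  tnth u 3 = tnth v 3 -> u = v.
Proof. by move=> *; apply: eq_from_tnth => i; case: (ord4P i) => ->. Qed.

Lemma M_rot x y z t : admissible [tuple x; y; z; t] ->
  let u := M [tuple x; y; z; t] in
  M [tuple x; z; t; y] = [tuple tnth u 1; tnth u 2; tnth u 0].
Proof.
move=> adm u.
pose p : 'S_4 := (tperm (1%R : 'I_4) (2%R : 'I_4) *
  tperm (1%R : 'I_4) (3%R : 'I_4))%g.
have p0 : p 0 = 0 by rewrite permM !permE.
have p1 : p 1 = 2 by rewrite permM !permE.
have p2 : p 2 = 3 by rewrite permM !permE.
have p3 : p 3 = 1 by rewrite permM !permE.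
have -> : [tuple x; z; t; y] = permute p [tuple x; y; z; t].
  by apply: tuple4_eq; rewrite /permute tnth_mktuple ?(p0, p1, p2, p3).
have p_even : odd_perm p = false by rewrite odd_mul_tperm odd_tperm.
apply: tuple3_eq.
- apply: (permute_even (j := 1) (a := 0) (b := 1) adm p_even);
  by rewrite ?p0 ?p1 !inE eqxx ?orbT.
- apply: (permute_even (j := 2) (a := 0) (b := 2) adm p_even);
  by rewrite ?p0 ?p2 !inE eqxx ?orbT.
- apply: (permute_even (j := 0) (a := 0) (b := 3) adm p_even);
  by rewrite ?p0 ?p3 !inE eqxx ?orbT.
Qed.

Lemma M_swap12_34 x y z t : admissible [tuple x; y; z; t] ->
  M [tuple y; x; t; z] = M [tuple x; y; z; t].
Proof.
move=> adm.
pose p : 'S_4 := (tperm (0%R : 'I_4) (1%R : 'I_4) *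
  tperm (2%R : 'I_4) (3%R : 'I_4))%g.
have p0 : p 0 = 1 by rewrite permM !permE.
have p1 : p 1 = 0 by rewrite permM !permE.
have p2 : p 2 = 3 by rewrite permM !permE.
have p3 : p 3 = 2 by rewrite permM !permE.
have -> : [tuple y; x; t; z] = permute p [tuple x; y; z; t].
  by apply: tuple4_eq; rewrite /permute tnth_mktuple ?(p0, p1, p2, p3).
have p_even : odd_perm p = false by rewrite odd_mul_tperm odd_tperm.
apply: tuple3_eq.
- apply: (permute_even (a := 2) (b := 3) adm p_even);
  by rewrite ?p2 ?p3 !inE ?eqxx ?orbT// finset.setUC eqxx ?orbT.
- apply: (permute_even (a := 0) (b := 2) adm p_even);
  by rewrite ?p0 ?p2 !inE ?eqxx ?orbT// finset.setUC eqxx ?orbT.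
- apply: (permute_even (a := 0) (b := 3) adm p_even);
  by rewrite ?p0 ?p3 !inE ?eqxx ?orbT// finset.setUC eqxx ?orbT.
Qed.

Lemma M_swap13_24 x y z t : admissible [tuple x; y; z; t] ->
  M [tuple z; t; x; y] = M [tuple x; y; z; t].
Proof.
move=> adm.
pose p : 'S_4 := (tperm (0%R : 'I_4) (2%R : 'I_4) *
  tperm (1%R : 'I_4) (3%R : 'I_4))%g.
have p0 : p 0 = 2 by rewrite permM !permE.
have p1 : p 1 = 3 by rewrite permM !permE.
have p2 : p 2 = 0 by rewrite permM !permE.
have p3 : p 3 = 1 by rewrite permM !permE.
have -> : [tuple z; t; x; y] = permute p [tuple x; y; z; t].
  by apply: tuple4_eq; rewrite /permute tnth_mktuple ?(p0, p1, p2, p3).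
have p_even : odd_perm p = false by rewrite odd_mul_tperm odd_tperm.
apply: tuple3_eq.
- apply: (permute_even (a := 0) (b := 1) adm p_even);
  by rewrite ?p0 ?p1 !inE ?eqxx ?orbT// finset.setUC eqxx ?orbT.
- apply: (permute_even (a := 3) (b := 1) adm p_even);
  by rewrite ?p3 ?p1 !inE ?eqxx ?orbT// finset.setUC eqxx ?orbT.
- apply: (permute_even (a := 0) (b := 3) adm p_even);
  by rewrite ?p0 ?p3 !inE ?eqxx ?orbT// finset.setUC eqxx ?orbT.
Qed.

Lemma M_swap23 x y z t : admissible [tuple x; y; z; t] ->
  tnth (M [tuple x; z; y; t]) 2 = (- tnth (M [tuple x; y; z; t]) 2%R)%E.
Proof.
move=> adm.
pose p : 'S_4 := tperm (1%R : 'I_4) (2%R : 'I_4).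
have p0 : p 0 = 0 by rewrite !permE.
have p1 : p 1 = 2 by rewrite !permE.
have p2 : p 2 = 1 by rewrite !permE.
have p3 : p 3 = 3 by rewrite !permE.
have -> : [tuple x; z; y; t] = permute p [tuple x; y; z; t].
  by apply: tuple4_eq; rewrite /permute tnth_mktuple ?(p0, p1, p2, p3).
rewrite (moebius_permute HM)// !tnth_mktuple odd_tperm /= mulN1e.
congr (- tnth _ _)%E.
by apply: (@phi_eq _ _ _ 0 3); rewrite ?p0 ?p3 !inE ?eqxx ?orbT.
Qed.

(** The logarithm of the cross ratio xy . zt / (xz . yt): the third component
    of [M], with 0 in place of an infinite value. The other two components are
    its values at the quadruples with the last three points rotated. *)
Definition lcr x y z t : R := fine (tnth (M [tuple x; y; z; t]) 2).

Lemma M_lcr x y z t :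
  x <> y -> x <> z -> x <> t -> y <> z -> y <> t -> z <> t ->
  M [tuple x; y; z; t] =
    [tuple (lcr x z t y)%:E; (lcr x t y z)%:E; (lcr x y z t)%:E].
Proof.
move=> xy xz xt yz yt zt.
have nd : nondegenerate [tuple x; y; z; t] by exact: nondegenerate4.
have adm := nondegenerate_admissible nd.
have [a [b [c [_ Mabc]]]] := (moebius_L4 HM adm).2 nd.
have E1 := M_rot adm.
have adm1 : admissible [tuple x; z; t; y].
  by apply: nondegenerate_admissible; apply: nondegenerate4 => //; congruence.
have E2 := M_rot adm1.
by rewrite /lcr E2 E1 /= Mabc.
Qed.

Lemma lcr_sum0 x y z t :
  x <> y -> x <> z -> x <> t -> y <> z -> y <> t -> z <> t ->
  lcr x z t y + lcr x t y z + lcr x y z t = 0.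
Proof.
move=> xy xz xt yz yt zt.
have nd : nondegenerate [tuple x; y; z; t] by exact: nondegenerate4.
have [a [b [c [abc0]]]] := (moebius_L4 HM (nondegenerate_admissible nd)).2 nd.
by rewrite M_lcr// => -[-> -> ->].
Qed.

Lemma lcr_swap12_34 x y z t : admissible [tuple x; y; z; t] ->
  lcr y x t z = lcr x y z t.
Proof. by move=> adm; rewrite /lcr M_swap12_34. Qed.

Lemma lcr_swap13_24 x y z t : admissible [tuple x; y; z; t] ->
  lcr z t x y = lcr x y z t.
Proof. by move=> adm; rewrite /lcr M_swap13_24. Qed.

Lemma lcr_swap23 x y z t : admissible [tuple x; y; z; t] ->
  lcr x z y t = - lcr x y z t.
Proof. by move=> adm; rewrite /lcr M_swap23// fineN. Qed.

Lemma lcr_id x y t : x <> y -> y <> t -> lcr x y y t = 0.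
Proof.
move=> xy yt.
have adm : admissible [tuple x; y; y; t].
  by apply: admissible4; intuition congruence.
by have := lcr_swap23 adm; lra.
Qed.

(** For a fixed outer pair [a, b] the cross ratios form an additive cocycle in
    the inner pair. The points [x], [y], [z] need not be distinct here: a cross
    ratio with equal inner points is 0, and exchanging them changes the sign. *)
Lemma lcr_cocycle a b x y z : a <> b -> a <> x -> a <> y -> a <> z ->
  b <> x -> b <> y -> b <> z -> lcr a x y b + lcr a y z b = lcr a x z b.
Proof.
move=> ab ax ay az bx bY bz.
have [<-|xy] := pselect (x = y); first by rewrite lcr_id ?add0r//; congruence.
have [<-|yz] := pselect (y = z); first by rewrite lcr_id ?addr0//; congruence.
have [<-|xz] := pselect (x = z).
  rewrite lcr_id; [|congruence..].
  rewrite (lcr_swap23 (x := a) (y := x)) ?subrr//.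
  by apply: nondegenerate_admissible; apply: nondegenerate4 => //; congruence.
have [||||||_ [l]] := @moebius_cocycle _ _ _ HM x z y a b; try congruence.
- by apply: nondegenerate_admissible; apply: nondegenerate5 => //; congruence.
- by apply: nondegenerate3 => //; congruence.
rewrite /cocycle_component => /(congr1 (fun u => tnth u 2)).
rewrite tnth_mktuple !M_lcr; [|congruence..].
by rewrite !(tnth_nth 0%E)/= => -[?]; lra.
Qed.

End Symmetries.

(** * Homogeneous coordinates and the corners *)

Section Corners.
Variable R : realType.
Implicit Types (a b c k C : R).

(** A triple of coordinates as the row vector underlying [homog]. *)
Definition row3 a b c : 'rV[R]_3 := \row_i tnth [tuple a; b; c] i.

Lemma homog_repr a b c : exists2 v : nzrow R, homog a b c = \pi v &
  val v = if (a, b, c) != (0, 0, 0) then row3 a b c else const_mx 1.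
Proof.
have <- : (row3 a b c \in @nonzero_row R) = ((a, b, c) != (0, 0, 0)).
  apply/idP/idP; rewrite inE /nonzero_row/=; apply: contra => /eqP.
    move=> [-> -> ->]; apply/eqP/rowP => i; rewrite !mxE.
    by case: (ord3P i) => ->.
  move=> /rowP abc; have := (abc 0, abc 1, abc 2); rewrite !mxE/= => -[[]].
  by rewrite !(tnth_nth 0)/= => -> -> ->.
by eexists; [exact: erefl|rewrite val_insubd].
Qed.

Lemma homog_scale k a b c : k != 0 ->
  homog (k * a) (k * b) (k * c) = homog a b c.
Proof.
move=> k0; have [[-> -> ->]|abc] := eqVneq (a, b, c) (0, 0, 0).
  by rewrite !mulr0.
symmetry; apply/homog_eq => //; last by exists k.
by rewrite !xpair_eqE !mulf_eq0 (negPf k0) -!xpair_eqE.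
Qed.

(** The cone of the vectors whose [i]-th coordinate exceeds [C] times the
    others in absolute value; for growing [C] these cones are a neighbourhood
    basis of the [i]-th corner in the projective plane. *)
Definition corner_cone C (i : 'I_3) : set 'rV[R]_3 :=
  [set v | forall j, j != i -> C * `|v 0 j| < `|v 0 i|].

Lemma corner_cone_scale C i k (v : 'rV[R]_3) : k != 0 ->
  corner_cone C i (k *: v) <-> corner_cone C i v.
Proof.
move=> k0; have k_gt0 : 0 < `|k| by rewrite normr_gt0.
by split=> vC j /vC; rewrite !mxE !normrM mulrCA ltr_pM2l.
Qed.

Lemma corner_cone_open C i : open (corner_cone C i).
Proof.
rewrite openE => v vC.
suff : nbhs v (fun u : 'rV[R]_3 => forall j, j != i -> C * `|u 0 j| < `|u 0 i|).
  by [].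
apply: (@filter_forall _ _ _ (nbhs v) (nbhs_filter v)) => j.
have [->|ji] := eqVneq j i; first exact: filterE.
pose f (u : 'rV[R]_3) : R := `|u 0 i| - C * `|u 0 j|.
have f_cont : {for v, continuous f}.
  have coord (l : 'I_3) :
      {for v, continuous (fun u : 'rV[R]_3 => `|u 0 l| : R)}.
    exact: (continuous_comp (@coord_continuous _ _ _ _ _ _)
      (@norm_continuous _ _ _)).
  apply: (@continuousB _ _ _ (fun u : 'rV[R]_3 => `|u 0 i| : R)
    (fun u => C * `|u 0 j|)).
    exact: coord.
  apply: continuousM; last exact: coord.
  exact: cst_continuous.
have : nbhs v (f @^-1` [set x | 0 < x]).
  apply: f_cont; apply: open_nbhs_nbhs; split; first exact: open_gt.
  by rewrite /f /= subr_gt0; exact: vC.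
by apply: filterS => u; rewrite /f /= subr_gt0.
Qed.

(** A cone, being open and invariant under scaling, descends to an open set of
    the projective plane. *)
Lemma corner_cone_nbhs C i :
  exists2 U : set (RP2 R), open U &
    forall v : nzrow R, U (\pi v) <-> corner_cone C i (val v).
Proof.
pose U : set (RP2 R) :=
  [set p | corner_cone C i (val (generic_quotient.repr p))].
have UE (v : nzrow R) : U (\pi v) <-> corner_cone C i (val v).
  rewrite /U/=.
  have /RP2_eq/asboolP[k k0 ->] :
      generic_quotient.repr (\pi_(RP2 R) v) = v %[mod RP2 R].
    by rewrite reprK.
  by rewrite corner_cone_scale.
exists U => //; apply/RP2_open; exists (corner_cone C i) => [|v].
  exact: corner_cone_open.
by split=> /UE.
Qed.

Lemma corner_cone_homog C i a b c (v : nzrow R) : 1 <= C ->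
  homog a b c = \pi v ->
  corner_cone C i (val v) <-> corner_cone C i (row3 a b c).
Proof.
move=> C1; have [w -> wE] := homog_repr a b c.
move=> /RP2_eq/asboolP[k k0 ->]; rewrite corner_cone_scale// {}wE.
(* For (0 : 0 : 0) neither its own coordinates nor those of the dummy value
   are in the cone. *)
case: ifPn => // /negPn/eqP[-> -> ->].
have [j ji] : exists j : 'I_3, j != i.
  by case: (ord3P i) => ->; [exists 1|exists 0|exists 0].
split=> /(_ _ ji).
  by rewrite !mxE normr1 mulr1 ltNge C1.
have row0 (l : 'I_3) : row3 0 0 0 0 l = 0.
  by rewrite !mxE; case: (ord3P l) => ->.
by rewrite !row0 normr0 mulr0 ltxx.
Qed.

(** The points (1 : 0 : 0), (0 : 1 : 0) and (0 : 0 : 1). *)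
Definition corner (i : 'I_3) : RP2 R :=
  homog (i == 0)%:R (i == 1)%:R (i == 2)%:R.

Lemma corner_repr i :
  exists2 v : nzrow R, corner i = \pi v & val v = delta_mx 0 i.
Proof.
have [v E vE] := homog_repr (i == 0)%:R (i == 1)%:R (i == 2)%:R.
exists v => //; rewrite vE; case: ifPn.
  move=> _; apply/rowP => j; rewrite !mxE (eq_sym j).
  by case: (ord3P j) => ->.
by case: (ord3P i) => ->; rewrite !xpair_eqE/= oner_eq0 ?andbF.
Qed.

Lemma cornerP (p : RP2 R) :
  (p = homog 1 0 0 \/ p = homog 0 1 0 \/ p = homog 0 0 1) <->
  exists i, p = corner i.
Proof.
split=> [[->|[->|->]]|[i ->]]; [by exists 0|by exists 1|by exists 2|].
by case: (ord3P i) => ->; rewrite /corner/=; [left|right; left|right; right].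
Qed.

Lemma corner_cone_corner C i : corner_cone C i (delta_mx 0 i).
Proof.
by move=> j ji; rewrite !mxE !eqxx (negPf ji) normr0 mulr0 normr1.
Qed.

(** Every neighbourhood of a corner contains a cone. *)
Lemma nbhs_corner_cone i (U : set (RP2 R)) : open_nbhs (corner i) U ->
  exists2 C, 1 <= C & forall v : nzrow R, corner_cone C i (val v) -> U (\pi v).
Proof.
case=> /RP2_open[V oV VU]; have [w -> wE] := corner_repr i.
move=> /VU; rewrite wE => Vi.
have /nbhs_ballP[e /= e0 eV] : nbhs (delta_mx 0 i : 'rV[R]_3) V.
  by exact: open_nbhs_nbhs.
exists (Num.max 1 e^-1); first by rewrite le_max lexx.
move=> v vC.
have vi0 : val v 0 i != 0.
  have [j ji] : exists j : 'I_3, j != i.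
    by case: (ord3P i) => ->; [exists 1|exists 0|exists 0].
  rewrite -normr_gt0; apply: le_lt_trans (vC j ji).
  by rewrite mulr_ge0// le_max ler01.
pose u := (val v 0 i)^-1 *: val v.
have u_nz : u \in @nonzero_row R.
  rewrite inE /nonzero_row/= scaler_eq0 invr_eq0 (negPf vi0)/=.
  by have := valP v; rewrite inE.
pose w' : nzrow R := Sub u u_nz.
have -> : \pi_(RP2 R) v = \pi_(RP2 R) w'.
  by apply/RP2_eq/asboolP; exists (val v 0 i)^-1; rewrite ?invr_eq0 ?SubK.
apply/VU; rewrite SubK; apply: eV; split=> // k j; rewrite ord1 !mxE eqxx/=.
have [->|ji] := eqVneq j i.
  by rewrite mulVf//; exact: ballxx.
rewrite /ball/= sub0r normrN normrM normfV mulrC ltr_pdivrMr ?normr_gt0//.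
rewrite -ltr_pdivrMl//; apply: le_lt_trans (vC j ji).
by rewrite ler_wpM2r// le_max lexx orbT.
Qed.

Variables (Z : Type) (M : 4.-tuple Z -> 3.-tuple (\bar R)).

Lemma corner_condition_bound i : corner_condition M ->
  exists2 C, 1 <= C & forall P a b c, admissible P ->
    crt M P = homog a b c -> ~ corner_cone C i (row3 a b c).
Proof.
move=> /(_ (corner i))[|U /nbhs_corner_cone[C C1 CU] U0].
  by apply/cornerP; exists i.
exists C => // P a b c admP crtP; have [v vE _] := homog_repr a b c.
move=> /(corner_cone_homog i C1 vE)/CU; rewrite -vE -crtP => UP.
by have : set0 (crt M P) by rewrite -U0; split=> //; exists P.
Qed.

Lemma bound_corner_condition C : 1 <= C ->
  (forall P, admissible P -> exists a b c,
    crt M P = homog a b c /\ forall i, ~ corner_cone C i (row3 a b c)) ->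
  corner_condition M.
Proof.
move=> C1 bound p /cornerP[i ->]; have [U oU UC] := corner_cone_nbhs C i.
exists U.
  by split=> //; have [v -> vE] := corner_repr i; apply/UC; rewrite vE;
    exact: corner_cone_corner.
rewrite -subset0 => _ [[P admP <-]].
have [a [b [c [-> notC]]]] := bound P admP.
have [v vE _] := homog_repr a b c; rewrite vE => /UC.
by move=> /(corner_cone_homog i C1 vE); exact: notC.
Qed.

End Corners.

(** * Bounded quasi-metrics *)

Section Bounded.
Variable R : realType.

(** Ptolemy's inequality for quasi-metrics: [a], [b], [c], [d] are the sides of
    a quadrilateral, in cyclic order, and [e], [f] its diagonals. The two
    triangles that contain the shortest side bound the two diagonals by the
    sides next to it, which are opposite to each other. *)
Lemma ptolemy (K a b c d e f : R) : 0 <= K -> 0 <= a -> 0 <= b -> 0 <= c ->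
  0 <= d -> 0 <= e -> 0 <= f ->
  e <= K * Num.max a b -> e <= K * Num.max c d ->
  f <= K * Num.max b c -> f <= K * Num.max a d ->
  e * f <= K ^+ 2 * Num.max (a * c) (b * d).
Proof.
move=> K0 a0 b0 c0 d0 e0 f0 eab ecd fbc fad.
have M2 x y : e <= K * x -> f <= K * y -> x * y <= Num.max (a * c) (b * d) ->
    e * f <= K ^+ 2 * Num.max (a * c) (b * d).
  move=> ex fy xy; apply: (@le_trans _ _ (K ^+ 2 * (x * y))).
    by rewrite expr2 mulrACA ler_pM.
  by rewrite ler_wpM2l// exprn_ge0.
have ac : a * c <= Num.max (a * c) (b * d) by rewrite le_max lexx.
have bd : b * d <= Num.max (a * c) (b * d) by rewrite le_max lexx orbT.
have ca : c * a <= Num.max (a * c) (b * d) by rewrite mulrC.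
have db : d * b <= Num.max (a * c) (b * d) by rewrite (mulrC d).
move: eab ecd fbc fad ac ca bd db; move: (Num.max (a * c) _) M2 => m M2.
by case: (leP a b) => ?; case: (leP c d) => ?; case: (leP b c) => ?;
  case: (leP a d) => ? *; 
  solve [exact: (M2 a c)|exact: (M2 c a)|exact: (M2 b d)|exact: (M2 d b)|lra].
Qed.

Variable Z : Type.
Implicit Types (r : Z -> Z -> R) (rho : Z -> Z -> \bar R).

(** An extended quasi-metric as a real function: the infinite distances to the
    point at infinity [w] are replaced by 1. *)
Record cancelled_quasi_metric (K : R) (w : Z) r : Prop := {
  cqm_ge1 : 1 <= K;
  cqm_sym : forall x y, r x y = r y x;
  cqm_ge0 : forall x y, 0 <= r x y;
  cqm_eq0 : forall x y, r x y = 0 <-> x = y;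
  cqm_inf : forall x, x <> w -> r x w = 1;
  cqm_triangle : forall x y z, x <> w -> y <> w -> z <> w ->
    r x z <= K * Num.max (r x y) (r y z) }.

Lemma cancel_extended K rho : extended_quasi_metric K rho ->
  exists w, cancelled_quasi_metric K w (fun x y => cancel_oo (rho x y)).
Proof.
move=> [rho0 rhoC [w [[winf ww [K1 fin _ eq0 tri]] _]]]; exists w.
have finE x y : x <> w -> y <> w -> exists2 s : R, 0 <= s &
    rho x y = s%:E /\ cancel_oo (rho x y) = s.
  move=> xw yw; have := fin x y xw yw; case: (rho x y) => [s| |]; last 2 first.
  - by rewrite ltxx andbF.
  - by rewrite leNgt ltNyr.
  by rewrite lee_fin => /andP[s0 _]; exists s.
have infE x : x <> w -> cancel_oo (rho x w) = 1.
  by move=> /winf ->; rewrite /cancel_oo eqxx.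
have infE' y : y <> w -> cancel_oo (rho w y) = 1 by rewrite rhoC; exact: infE.
have wwE : cancel_oo (rho w w) = 0 by rewrite ww.
split=> //.
- by move=> x y; rewrite rhoC.
- move=> x y; rewrite /cancel_oo; case: ifP => // _.
  by apply: fine_ge0.
- move=> x y; have [->|xw] := pselect (x = w).
    have [->|yw] := pselect (y = w); first by rewrite wwE.
    by rewrite infE'//; split=> [/eqP|/esym//]; rewrite oner_eq0.
  have [->|yw] := pselect (y = w).
    by rewrite infE//; split=> [/eqP|//]; rewrite oner_eq0.
  rewrite -eq0//; have [s _ [-> ->]] := finE x y xw yw.
  by split=> [->|[]].
- move=> x y z xw yw zw; have := tri x y z xw yw zw.
  have [s _ [-> ->]] := finE x z xw zw; have [t _ [-> ->]] := finE x y xw yw.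
  have [u _ [-> ->]] := finE y z yw zw.
  by rewrite -EFin_max -EFinM lee_fin.
Qed.

(** Dividing the distances by a factor at each of the two points does not
    change the cross ratio triples. *)
Lemma homog_conformal r (m : Z -> R) x y z t : (forall x, m x != 0) ->
  let r' x y := r x y / (m x * m y) in
  homog (r' x y * r' z t) (r' x z * r' y t) (r' x t * r' y z) =
  homog (r x y * r z t) (r x z * r y t) (r x t * r y z).
Proof.
move=> m0 r'; pose k := (m x * m y * m z * m t)^-1.
have k0 : k != 0 by rewrite invr_eq0 !mulf_neq0.
rewrite -[RHS](homog_scale _ _ _ k0).
by congr homog; rewrite /r' /k; field; rewrite !m0.
Qed.

Section Inversion.
Variables (K : R) (w o : Z) (r : Z -> Z -> R).
Hypotheses (qm : cancelled_quasi_metric K w r) (ow : o <> w).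

(** The distance to [o], bounded below by 1, behaves like the distance to an
    additional point. *)
Definition radius x := Num.max 1 (r x o).

(** The distance [r] seen from [o] by inversion: it is bounded, and the point
    at infinity [w] becomes an ordinary point, as [radius w] is 1. *)
Definition bounded_dist x y := r x y / (radius x * radius y).

Let K_ge1 : 1 <= K. Proof. exact: cqm_ge1 qm. Qed.
Let rC x y : r x y = r y x. Proof. exact: cqm_sym qm x y. Qed.

Lemma cqm_refl x : r x x = 0. Proof. exact/(cqm_eq0 qm). Qed.

Lemma radius_ge1 x : 1 <= radius x. Proof. by rewrite le_max lexx. Qed.
Hint Resolve radius_ge1 : core.

Lemma radius_gt0 x : 0 < radius x.
Proof. exact: lt_le_trans (radius_ge1 x). Qed.
Hint Resolve radius_gt0 : core.

Lemma radius_inf : radius w = 1.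
Proof. by rewrite /radius rC (cqm_inf qm)// maxxx. Qed.

Lemma radius_le x y : x <> w -> y <> w ->
  radius x <= K * Num.max (r x y) (radius y).
Proof.
move=> xw yw; have K0 : 0 <= K := le_trans ler01 K_ge1.
rewrite /radius ge_max maxCA; apply/andP; split.
  rewrite -[leLHS]mulr1 ler_pM// le_max lexx//.
apply: le_trans (cqm_triangle qm xw yw ow) _.
by rewrite ler_wpM2l// le_max lexx orbT.
Qed.

Lemma dist_le_radius x y : x <> w -> y <> w ->
  r x y <= K * Num.max (radius x) (radius y).
Proof.
move=> xw yw; have K0 : 0 <= K := le_trans ler01 K_ge1.
apply: le_trans (cqm_triangle qm xw ow yw) _.
by rewrite ler_wpM2l// (rC o) ge_max !le_max !lexx !orbT.
Qed.

Lemma bounded_dist_le x y : bounded_dist x y <= K.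
Proof.
rewrite /bounded_dist ler_pdivrMr ?mulr_gt0//.
have K0 : 0 <= K := le_trans ler01 K_ge1.
have Kxy : 1 <= K * (radius x * radius y) by rewrite !mulr_ege1.
have [->|xy] := pselect (x = y); first by rewrite cqm_refl !mulr_ge0// ltW.
have [xw|xw] := pselect (x = w).
  by rewrite [r x y]rC xw (cqm_inf qm) -?xw//; congruence.
have [yw|yw] := pselect (y = w).
  by rewrite [r x y](_ : _ = 1)// yw (cqm_inf qm).
apply: le_trans (dist_le_radius xw yw) _.
rewrite ler_wpM2l// ge_max.
by rewrite ler_peMl ?ler_peMr// ltW.
Qed.

Lemma bounded_dist_triangle x y z :
  bounded_dist x z <= K ^+ 2 * Num.max (bounded_dist x y) (bounded_dist y z).
Proof.
(* Multiply by the three radii. *)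
suff key : r x z * radius y <=
    K ^+ 2 * Num.max (r x y * radius z) (r y z * radius x).
  pose k := (radius x * radius y * radius z)^-1.
  have k0 : 0 <= k by rewrite invr_ge0 !mulr_ge0// ltW.
  have -> : bounded_dist x z = k * (r x z * radius y).
    by rewrite /bounded_dist /k; field; rewrite !gt_eqF.
  have -> : bounded_dist x y = k * (r x y * radius z).
    by rewrite /bounded_dist /k; field; rewrite !gt_eqF.
  have -> : bounded_dist y z = k * (r y z * radius x).
    by rewrite /bounded_dist /k; field; rewrite !gt_eqF.
  by rewrite -maxr_pMr// [leRHS]mulrCA ler_wpM2l.
have K2 : 1 <= K ^+ 2 by rewrite exprn_ege1.
have KK2 : K <= K ^+ 2 by rewrite expr2 ler_peMr// (le_trans ler01).
have K0 : 0 <= K := le_trans ler01 K_ge1.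
have wK2 u v : 0 <= v -> u <= K * v -> u <= K ^+ 2 * v.
  by move=> v0 uv; apply: le_trans uv _; rewrite ler_wpM2r.
have r0 := cqm_ge0 qm; have m0 u : 0 <= radius u := ltW (radius_gt0 u).
have max0 (u v : R) : 0 <= u -> 0 <= Num.max u v by rewrite le_max => ->.
(* A triple containing [w] reduces to one of the triangle inequalities for
   [radius], since [w] is at distance 1 from the other points. *)
have [->|xz] := pselect (x = z).
  by rewrite cqm_refl mul0r mulr_ge0 ?exprn_ge0// max0// mulr_ge0.
have [yw|yw] := pselect (y = w).
  have [xw|xw] := pselect (x = w).
    by subst; rewrite -[leLHS]mul1r ler_pM// ?mulr_ge0// le_max lexx orbT.
  have [zw|zw] := pselect (z = w).
    by subst; rewrite -[leLHS]mul1r ler_pM// ?mulr_ge0// le_max lexx.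
  subst y; rewrite radius_inf mulr1 (cqm_inf qm)// (rC w) (cqm_inf qm)// !mul1r.
  apply: wK2; first exact: max0.
  by rewrite maxC dist_le_radius.
have [xw|xw] := pselect (x = w).
  subst x; have zw : z <> w by congruence.
  rewrite (rC w) (cqm_inf qm)// (rC w y) (cqm_inf qm)// radius_inf mulr1 !mul1r.
  by apply: wK2; [exact: max0|rewrite maxC radius_le].
have [zw|zw] := pselect (z = w).
  subst z; rewrite !(cqm_inf qm)// radius_inf mulr1 !mul1r.
  by apply: wK2; [exact: max0|rewrite rC radius_le].
apply: ptolemy => //.
- exact: (cqm_triangle qm).
- by rewrite maxC dist_le_radius.
- exact: radius_le.
- by rewrite rC radius_le.
Qed.

End Inversion.
End Bounded.

(** * Quasi-metrics and the corner condition *)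

Section CornerBound.
Variables (R : realType) (Z : Type) (M : 4.-tuple Z -> 3.-tuple (\bar R)).

Lemma bounded_quasi_metric K (rho : Z -> Z -> \bar R) :
  (exists x y : Z, x <> y) -> extended_quasi_metric K rho -> induces rho M ->
  exists rho' : Z -> Z -> \bar R,
    [/\ quasi_metric (K ^+ 2) rho', bounded_distance rho' & induces rho' M].
Proof.
move=> [x0 [y0 xy0]] /cancel_extended[w]; set r := fun x y : Z => _ => qm indM.
have [p pw] : exists p, p <> w.
  by have [xw|] := pselect (x0 = w); [exists y0; congruence|exists x0].
pose s := bounded_dist p r.
have s_ge0 x y : 0 <= s x y.
  by rewrite divr_ge0 ?(cqm_ge0 qm)// mulr_ge0// ltW// radius_gt0.
have m0 x : radius p r x != 0 by rewrite gt_eqF// radius_gt0.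
exists (fun x y => (s x y)%:E); split.
- split.
  + by rewrite exprn_ege1// (cqm_ge1 qm).
  + by move=> x y _ _; rewrite lee_fin s_ge0 ltry.
  + move=> x y _ _; rewrite /s /bounded_dist (cqm_sym qm).
    by rewrite mulrC (mulrC (radius _ _ x)) mulrC.
  + move=> x y _ _; rewrite -(cqm_eq0 qm) /s /bounded_dist; split=> [[/eqP]|->].
      by rewrite mulf_eq0 invr_eq0 mulf_eq0 !(negPf (m0 _)) !orbF => /eqP.
    by rewrite mul0r.
  + move=> x y z _ _ _; rewrite -EFin_max -EFinM lee_fin.
    exact: (bounded_dist_triangle qm pw).
- apply: (@le_lt_trans _ _ K%:E); last exact: ltry.
  by apply: ge_ereal_sup => _ [xy _ <-]; rewrite lee_fin;
    exact: (bounded_dist_le qm pw).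
- move=> x y z t adm /=; rewrite indM//.
  exact/esym/(homog_conformal r x y z t m0).
Qed.

Lemma quasi_metric_corner K (rho : Z -> Z -> \bar R) :
  quasi_metric K rho -> induces rho M -> corner_condition M.
Proof.
move=> [K1 fin rhoC _ tri] indM; pose r x y := cancel_oo (rho x y).
have rE x y : rho x y = (r x y)%:E.
  rewrite /r /cancel_oo; have := fin x y I I; case: (rho x y) => [//| |].
    by rewrite ltxx andbF.
  by rewrite leNgt ltNyr.
have r0 x y : 0 <= r x y.
  by have := fin x y I I; rewrite rE lee_fin => /andP[].
have rC x y : r x y = r y x by rewrite /r rhoC.
have rT x y z : r x z <= K * Num.max (r x y) (r y z).
  by have := tri x y z I I I; rewrite !rE -EFin_max -EFinM lee_fin.
have K0 : 0 <= K := le_trans ler01 K1.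
have pt x y z t :
    r x z * r y t <= K ^+ 2 * Num.max (r x y * r z t) (r y z * r t x).
  apply: ptolemy => //; first by rewrite maxC (rC t x) (rC z t).
  by rewrite (rC x y) (rC t x).
apply: (@bound_corner_condition _ _ _ (K ^+ 2)); first by rewrite exprn_ege1.
move=> P; have -> : P = [tuple tnth P 0; tnth P 1; tnth P 2; tnth P 3].
  exact: tuple4_eq.
move: (tnth P 0) (tnth P 1) (tnth P 2) (tnth P 3) => x y z t adm.
exists (r x y * r z t), (r x z * r y t), (r x t * r y z).
split=> [|i]; first exact: indM.
have row3E (a b c : R) : (row3 a b c 0 0 = a) * (row3 a b c 0 1 = b) *
  (row3 a b c 0 2 = c) by rewrite !mxE.
have nle (a b c : R) : K ^+ 2 * `|b| < `|a| -> K ^+ 2 * `|c| < `|a| ->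
    0 <= a -> 0 <= b -> 0 <= c -> ~ (a <= K ^+ 2 * Num.max b c).
  move=> + + a0 b0 c0; rewrite !ger0_norm// => ba ca.
  apply/negP; rewrite -ltNge.
  by rewrite maxr_pMr ?exprn_ge0// gt_max ba ca.
case: (ord3P i) => -> cone.
- have := cone 1 isT; have := cone 2 isT; rewrite !row3E => c2 c1.
  apply: (nle _ _ _ c1 c2); rewrite ?mulr_ge0//.
  by have := pt x z y t; rewrite (rC z y) (rC t x) (mulrC (r x t)).
- have := cone 0 isT; have := cone 2 isT; rewrite !row3E => c2 c1.
  apply: (nle _ _ _ c1 c2); rewrite ?mulr_ge0//.
  by have := pt x y z t; rewrite (rC t x) (mulrC (r x t)).
- have := cone 0 isT; have := cone 1 isT; rewrite !row3E => c2 c1.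
  apply: (nle _ _ _ c1 c2); rewrite ?mulr_ge0//.
  by have := pt x y t z; rewrite (rC t z) (rC z x) (mulrC (r y t)).
Qed.

Lemma corner_bound : corner_condition M -> exists2 C, 1 <= C &
  forall P a b c, admissible P -> 0 <= a -> 0 <= b -> 0 <= c ->
    crt M P = homog a b c -> a <= C * Num.max b c.
Proof.
move=> /(@corner_condition_bound _ _ _ 0)[C C1 notC]; exists C => //.
move=> P a b c admP a0 b0 c0 /(notC _ _ _ _ admP); apply: contra_notP => /negP.
rewrite -ltNge maxr_pMr ?(le_trans ler01)// gt_max => /andP[ba ca] j.
by case: (ord3P j) => -> // _; rewrite !mxE/= !(tnth_nth 0)/= !ger0_norm.
Qed.

End CornerBound.

(** * The metric with a given point at infinity *)

Section Construction.
Variables (R : realType) (Z : Type) (M : 4.-tuple Z -> 3.-tuple (\bar R)).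
Hypothesis HM : moebius_structure M.
Variables w p q : Z.
Hypotheses (wp : w <> p) (pq : p <> q) (wq : w <> q).
Implicit Types x y z t : Z.

(** With [w] at infinity the cross ratio xy . zw / (xz . yw) is the ratio
    xy / xz of distances; this is its logarithm. *)
Definition lratio x y z : R := lcr M x y z w.

Lemma lratioN x y z : x <> y -> x <> z -> x <> w -> y <> w -> z <> w ->
  lratio x z y = - lratio x y z.
Proof.
move=> *; apply: lcr_swap23 => //.
by apply: admissible4; intuition congruence.
Qed.

Lemma lratio_id x y : x <> y -> y <> w -> lratio x y y = 0.
Proof. by move=> xy yw; exact: lcr_id. Qed.

Lemma lratio_cocycle x y z t : x <> w -> y <> w -> z <> w -> t <> w ->
  x <> y -> x <> z -> x <> t -> lratio x y z + lratio x z t = lratio x y t.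
Proof. by move=> *; apply: lcr_cocycle => //; congruence. Qed.

Lemma lratio_sum0 x y z : x <> w -> y <> w -> z <> w ->
  x <> y -> x <> z -> y <> z -> lratio x y z + lratio y z x + lratio z x y = 0.
Proof.
move=> xw yw zw xy xz yz; have := lcr_sum0 HM xy xz xw yz yw zw.
rewrite -(lcr_swap13_24 HM (x := x) (y := w)); last first.
  by apply: admissible4; intuition congruence.
rewrite -(lcr_swap12_34 HM (x := x) (y := z)); last first.
  by apply: admissible4; intuition congruence.
by rewrite /lratio; lra.
Qed.

(** The logarithm of the distance in Z minus [w], normalized to be 0 at
    the pair [p], [q]. As [lratio] compares distances from a common point, the
    pair [x, y] is compared with [x, p] and this one with [p, q]; for [x] equal
    to [p] a single comparison remains. *)
Definition ldist x y : R :=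
  if pselect (x = p) then lratio p y q else lratio x y p + lratio p x q.

Lemma ldistB x y z : x <> w -> y <> w -> z <> w -> x <> y -> x <> z ->
  ldist x y - ldist x z = lratio x y z.
Proof.
move=> xw yw zw xy xz; rewrite /ldist; case: pselect => [xp|xp] /=.
  have : lratio x y z + lratio x z q = lratio x y q.
    by apply: lratio_cocycle; congruence.
  by rewrite -xp; lra.
have : lratio x y z + lratio x z p = lratio x y p.
  by apply: lratio_cocycle; congruence.
by lra.
Qed.

Lemma ldistC x y : x <> w -> y <> w -> x <> y -> ldist x y = ldist y x.
Proof.
move=> xw yw xy; rewrite /ldist.
case: pselect => [xp|xp]; case: pselect => [yp|yp] /=; try congruence.
- by rewrite xp lratio_id ?add0r//; congruence.
- by rewrite yp lratio_id ?add0r//; congruence.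
have := @lratio_sum0 x y p xw yw (nesym wp) xy xp yp.
have : lratio p x y + lratio p y q = lratio p x q.
  by apply: lratio_cocycle; congruence.
have : lratio y p x = - lratio y x p by apply: lratioN; congruence.
by lra.
Qed.

(** The logarithm of the distance between distinct points, an infinite
    distance being counted as 1. *)
Definition log_dist x y : R :=
  if pselect (x = w \/ y = w) then 0 else ldist x y.

Lemma log_distE x y : x <> w -> y <> w -> log_dist x y = ldist x y.
Proof. by move=> xw yw; rewrite /log_dist; case: pselect => // -[]. Qed.

Lemma log_dist_wr x : log_dist x w = 0.
Proof. by rewrite /log_dist; case: pselect => // -[]; right. Qed.

Lemma log_dist_wl y : log_dist w y = 0.
Proof. by rewrite /log_dist; case: pselect => // -[]; left. Qed.

Lemma log_distC x y : x <> y -> log_dist x y = log_dist y x.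
Proof.
have [->|xw] := pselect (x = w); first by rewrite log_dist_wr log_dist_wl.
have [->|yw] := pselect (y = w); first by rewrite log_dist_wr log_dist_wl.
by move=> xy; rewrite !log_distE// ldistC.
Qed.

Lemma log_distB x y z : x <> w -> y <> w -> z <> w -> x <> y -> x <> z ->
  log_dist x y - log_dist x z = lcr M x y z w.
Proof. by move=> *; rewrite !log_distE// ldistB. Qed.

Lemma lcr_log_dist x y z t :
  x <> y -> x <> z -> x <> t -> y <> z -> y <> t -> z <> t ->
  lcr M x y z t = log_dist x y + log_dist z t - log_dist x z - log_dist y t.
Proof.
move=> xy xz xt yz yt zt.
have adm : admissible [tuple x; y; z; t].
  by apply: admissible4; intuition congruence.
have C12 := log_distC xy; have C34 := log_distC zt.
have C13 := log_distC xz; have C24 := log_distC yt.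
have [tw|tw] := pselect (t = w).
  have : log_dist x y - log_dist x z = lcr M x y z w.
    by apply: log_distB; congruence.
  by rewrite tw !log_dist_wr; lra.
have [zw|zw] := pselect (z = w).
  have : log_dist y x - log_dist y t = lcr M y x t w.
    by apply: log_distB; congruence.
  by rewrite zw -zw (lcr_swap12_34 HM)// zw log_dist_wr log_dist_wl C12; lra.
have [yw|yw] := pselect (y = w).
  have : log_dist z t - log_dist z x = lcr M z t x w.
    by apply: log_distB; congruence.
  by rewrite -yw (lcr_swap13_24 HM)// yw log_dist_wr log_dist_wl C13; lra.
have [xw|xw] := pselect (x = w).
  have : log_dist t z - log_dist t y = lcr M t z y w.
    by apply: log_distB; congruence.
  rewrite -xw -(lcr_swap12_34 HM adm) -(lcr_swap13_24 HM (x := y)).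
    by rewrite xw !log_dist_wl C34 C24; lra.
  by apply: admissible4; intuition congruence.
(* With [w] inserted between the inner points, each of the two cross ratios
   is a quotient of two distances. *)
have : lcr M x y w t + lcr M x w z t = lcr M x y z t.
  by apply: lcr_cocycle => //; congruence.
have : log_dist y x - log_dist y t = lcr M y x t w.
  by apply: log_distB; congruence.
have : log_dist z x - log_dist z t = lcr M z x t w.
  by apply: log_distB; congruence.
have -> : lcr M x w z t = - lcr M x z w t.
  by apply: (lcr_swap23 HM); apply: admissible4; intuition congruence.
have -> : lcr M y x t w = lcr M x y w t.
  by apply: (lcr_swap12_34 HM); apply: admissible4; intuition congruence.
have -> : lcr M z x t w = lcr M x z w t.
  by apply: (lcr_swap12_34 HM); apply: admissible4; intuition congruence.
by lra.
Qed.

(** The distance with point at infinity [w], an infinite distance being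
    replaced by 1. *)
Definition real_dist x y : R :=
  if pselect (x = y) then 0 else expR (log_dist x y).

Lemma real_distE x y : x <> y -> real_dist x y = expR (log_dist x y).
Proof. by move=> xy; rewrite /real_dist; case: pselect. Qed.

Lemma real_dist_refl x : real_dist x x = 0.
Proof. by rewrite /real_dist; case: pselect. Qed.

Lemma real_dist_gt0 x y : x <> y -> 0 < real_dist x y.
Proof. by move=> xy; rewrite real_distE// expR_gt0. Qed.

Lemma real_dist_ge0 x y : 0 <= real_dist x y.
Proof.
have [->|xy] := pselect (x = y); first by rewrite real_dist_refl.
exact/ltW/real_dist_gt0.
Qed.

Lemma real_dist_eq0 x y : real_dist x y = 0 <-> x = y.
Proof.
split=> [|->]; last exact: real_dist_refl.
have [//|/real_dist_gt0] := pselect (x = y).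
by rewrite lt_neqAle eq_sym => /andP[/eqP].
Qed.

Lemma real_distC x y : real_dist x y = real_dist y x.
Proof.
have [->//|xy] := pselect (x = y).
by rewrite (real_distE xy) (real_distE (nesym xy)) log_distC.
Qed.

Lemma real_dist_w x : x <> w -> real_dist x w = 1.
Proof. by move=> xw; rewrite real_distE// log_dist_wr expR0. Qed.

Lemma crt_of_fin (a b c : R) : crt_of [tuple a%:E; b%:E; c%:E] =
  homog (expR ((c - b) / 3)) (expR ((a - c) / 3)) (expR ((b - a) / 3)).
Proof.
rewrite /crt_of; do 3?case: eqP => [/(congr1 val)//|_].
by rewrite !(tnth_nth 0%E).
Qed.

Lemma crt_of_Linf1 : crt_of (Linf1 R) = homog 0 1 1.
Proof. by rewrite /crt_of eqxx. Qed.

Lemma crt_of_Linf2 : crt_of (Linf2 R) = homog 1 0 1.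
Proof. by rewrite /crt_of eqxx; case: eqP => // /(congr1 val). Qed.

Lemma crt_of_Linf3 : crt_of (Linf3 R) = homog 1 1 0.
Proof. by rewrite /crt_of eqxx; do 2!case: eqP => [/(congr1 val)//|_]. Qed.

Lemma crt_log (a b c : R) :
  crt_of [tuple (b - c)%:E; (c - a)%:E; (a - b)%:E] =
  homog (expR a) (expR b) (expR c).
Proof.
(* Normalize the logarithms of the coordinates to have sum 0. *)
rewrite crt_of_fin -[RHS](homog_scale (k := expR (- (a + b + c) / 3))).
  by apply: (f_equal3 (@homog R)); apply: etrans (expRD _ _); congr expR; lra.
by rewrite gt_eqF// expR_gt0.
Qed.

(** At a degenerate quadruple both triples are determined by which of the
    three products vanishes. *)
Lemma crt_degenerate (r : Z -> Z -> R) x y z t :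
  (forall x, r x x = 0) -> (forall x y, r x y = r y x) ->
  (forall x y, x <> y -> 0 < r x y) ->
  admissible [tuple x; y; z; t] -> ~ nondegenerate [tuple x; y; z; t] ->
  crt M [tuple x; y; z; t] =
    homog (r x y * r z t) (r x z * r y t) (r x t * r y z).
Proof.
move=> r0 rC r_gt0 adm deg.
have scale1 (a : R) : 0 < a -> homog 0 a a = homog 0 1 1.
  move=> a0; rewrite -[RHS](homog_scale (k := a)) ?gt_eqF//.
  by rewrite mulr0 mulr1.
have scale2 (a : R) : 0 < a -> homog a 0 a = homog 1 0 1.
  move=> a0; rewrite -[RHS](homog_scale (k := a)) ?gt_eqF//.
  by rewrite mulr0 mulr1.
have scale3 (a : R) : 0 < a -> homog a a 0 = homog 1 1 0.
  move=> a0; rewrite -[RHS](homog_scale (k := a)) ?gt_eqF//.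
  by rewrite mulr0 mulr1.
have pos a b c d : a <> b -> c <> d -> 0 < r a b * r c d.
  by move=> ab cd; rewrite mulr_gt0// r_gt0.
have adm_pair (a b c : Z) : a <> b -> a <> c -> admissible [tuple a; a; b; c].
  by move=> ab ac; apply: admissible4; intuition congruence.
have M12 a b c : a <> b -> a <> c -> M [tuple a; a; b; c] = Linf1 R.
  by move=> ab ac; apply: (moebius_Linf1 HM); exact: adm_pair.
have M14 a b c : a <> b -> a <> c -> M [tuple a; b; c; a] = Linf3 R.
  by move=> ab ac; rewrite (M_rot HM (adm_pair a b c ab ac)) M12.
have M13 a b c : a <> b -> a <> c -> M [tuple a; b; a; c] = Linf2 R.
  move=> ab ac; rewrite (M_rot HM (y := c) (z := b) (t := a)).
    by rewrite M14.
  by apply: admissible4; intuition congruence.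
have [[[xy xz xt] [yz yt zt]]|] := admissible4P adm.
  by case: deg; exact: nondegenerate4.
rewrite /crt; case=> [[eq12 xz xt]|[eq34 zx zy]|
    [[eq13 xy xt]|[eq24 yx yz]|[[eq14 xy xz]|[eq23 yx yt]]]]; subst.
- rewrite M12// crt_of_Linf1 r0 mul0r (mulrC (r _ t)) [RHS]scale1//.
  exact: pos.
- rewrite -(M_swap13_24 HM adm) M12// crt_of_Linf1 r0 mulr0.
  by rewrite [RHS]scale1//; apply: pos; exact: nesym.
- rewrite M13// crt_of_Linf2 r0 mul0r (rC _ z) mulrC [RHS]scale2//.
  by apply: pos => //; exact: nesym.
- rewrite -(M_swap12_34 HM adm) M13// crt_of_Linf2 r0 mulr0.
  by rewrite (rC z) [RHS]scale2//; apply: pos => //; exact: nesym.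
- rewrite M14// crt_of_Linf3 r0 mul0r.
  by rewrite (rC z) (rC y) mulrC [RHS]scale3//; apply: pos => //; exact: nesym.
- rewrite -(M_swap12_34 HM adm) M14// crt_of_Linf3 r0 mulr0.
  by rewrite [RHS]scale3//; apply: pos => //; exact: nesym.
Qed.

Lemma crt_real_dist x y z t : admissible [tuple x; y; z; t] ->
  crt M [tuple x; y; z; t] =
  homog (real_dist x y * real_dist z t) (real_dist x z * real_dist y t)
        (real_dist x t * real_dist y z).
Proof.
move=> adm.
have [nd|deg] := pselect (nondegenerate [tuple x; y; z; t]); last first.
  apply: crt_degenerate => //.
  - exact: real_dist_refl.
  - exact: real_distC.
  - exact: real_dist_gt0.
have [[xy xz xt] [yz yt zt]] := nondegenerate4_neq nd.
rewrite /crt (M_lcr HM)// !real_distE// -!expRD -crt_log.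
have lcrE : lcr M x y z t = _ := lcr_log_dist xy xz xt yz yt zt.
have lcrE1 : lcr M x z t y = _ :=
  lcr_log_dist xz xt xy zt (nesym yz) (nesym yt).
have lcrE2 : lcr M x t y z = _ :=
  lcr_log_dist xt xy xz (nesym yt) (nesym zt) yz.
have C34 := log_distC zt; have C24 := log_distC yt; have C23 := log_distC yz.
by congr crt_of; apply: tuple3_eq; rewrite !(tnth_nth 0%E)/=; congr EFin; lra.
Qed.

End Construction.

(** * Strong Moebius structures *)

Lemma strong_extended_quasi_metric (R : realType) (Z : Type)
    (M : 4.-tuple Z -> 3.-tuple (\bar R)) : strong_moebius_structure M ->
  exists rho : Z -> Z -> \bar R,
    (exists K : R, extended_quasi_metric K rho) /\ induces rho M.
Proof.
move=> [HM /corner_bound[C C1 bound]].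
have [w [p [q [wp pq wq]]]] := three_points HM.
pose r := real_dist M w p q.
have r0 x : r x x = 0 by exact: real_dist_refl.
have rC x y : r x y = r y x by exact: real_distC.
have r_ge0 x y : 0 <= r x y by exact: real_dist_ge0.
have rw x : x <> w -> r x w = 1 by exact: real_dist_w.
have r_eq0 x y : r x y = 0 <-> x = y by exact: real_dist_eq0.
have r_crt x y z t : admissible [tuple x; y; z; t] -> crt M [tuple x; y; z; t] =
    homog (r x y * r z t) (r x z * r y t) (r x t * r y z).
  exact: crt_real_dist.
clearbody r.
have C0 : 0 <= C by exact: le_trans ler01 C1.
have tri x y z : x <> w -> y <> w -> z <> w ->
    r x z <= C * Num.max (r x y) (r y z).
  move=> xw yw zw.
  have max0 : 0 <= Num.max (r x y) (r y z) by rewrite le_max r_ge0.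
  have [->|xz] := pselect (x = z); first by rewrite r0 mulr_ge0// le_max r_ge0.
  have [->|xy] := pselect (x = y).
    by rewrite r0 -[leLHS]mul1r ler_pM// le_max lexx orbT.
  have [->|yz] := pselect (y = z).
    by rewrite r0 -[leLHS]mul1r ler_pM// le_max lexx.
  have adm : admissible [tuple x; z; y; w].
    by apply: admissible4; intuition congruence.
  have := r_crt _ _ _ _ adm; rewrite !rw// !(mulr1, mul1r) (rC z).
  exact: bound.
pose rho x y : \bar R :=
  if pselect ((x = w \/ y = w) /\ x <> y) then +oo%E else (r x y)%:E.
have rhoE x y : x <> w -> y <> w -> rho x y = (r x y)%:E.
  by move=> xw yw; rewrite /rho; case: pselect => // -[[]].
have rho_inf x : x <> w -> rho x w = +oo%E.
  by move=> xw; rewrite /rho; case: pselect => // -[]; split=> //; right.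
have cancelE x y : cancel_oo (rho x y) = r x y.
  rewrite /rho; case: pselect => //= e; rewrite /cancel_oo eqxx.
  case: e => -[-> /nesym|->] ?; last by rewrite rw.
  by rewrite rC rw.
exists rho; split; last first.
  by move=> x y z t adm /=; rewrite !cancelE; exact: r_crt.
exists C; split.
- by move=> x y; rewrite /rho; case: pselect => *; rewrite ?leey ?lee_fin.
- move=> x y; rewrite /rho (rC y).
  by case: pselect => a; case: pselect => b //; exfalso; intuition congruence.
exists w; split.
  split=> //.
    by rewrite /rho r0; case: pselect => // -[].
  split=> //.
  + by move=> x y xw yw; rewrite rhoE// lee_fin r_ge0 ltry.
  + by move=> x y xw yw; rewrite !rhoE// rC.
  + by move=> x y xw yw; rewrite rhoE// -r_eq0; split=> [[]|->].
  + by move=> x y z xw yw zw; rewrite !rhoE// -EFin_max -EFinM lee_fin tri.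
move=> w' [inf' _ _]; apply: contrapT => ww'.
(* A second point at infinity would be at infinite distance from a third
   point, which is [p] or [q]. *)
have [u uw uw'] : exists2 u, u <> w & u <> w'.
  by have [pw'|pw'] := pselect (p = w'); [exists q|exists p]; congruence.
by have := inf' u uw'; rewrite rhoE//; exact: nesym.
Qed.

Theorem proposition3p3 (R : realType) (Z : Type)
    (M : 4.-tuple Z -> 3.-tuple (\bar R)) (HM : moebius_structure M) :
  ((exists rho : Z -> Z -> \bar R,
      (exists K : R, extended_quasi_metric K rho) /\ induces rho M) <->
   strong_moebius_structure M) /\
  (forall K : R,
     (exists rho : Z -> Z -> \bar R,
        extended_quasi_metric K rho /\ induces rho M) ->
     exists rho : Z -> Z -> \bar R,
       [/\ quasi_metric (K ^+ 2) rho, bounded_distance rho & induces rho M]).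
Proof.
have two_points : exists x y : Z, x <> y.
  by have [x [y [z [xy _ _]]]] := three_points HM; exists x, y.
have bounded K (rho : Z -> Z -> \bar R) :=
  @bounded_quasi_metric R Z M K rho two_points.
split=> [|K [rho [qm indM]]]; last exact: bounded qm indM.
split; last exact: strong_extended_quasi_metric.
move=> [rho [[K qm] indM]]; split=> //.
have [rho' [qm' _ indM']] := bounded _ _ qm indM.
exact: quasi_metric_corner qm' indM'.
Qed.
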